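(* Let $\ell(\alpha,0)$ be a line of $\mathbb A$ ($\alpha\in\mathrm{Hom}(U,W)$, $\alpha\neq0$), and let $M$ be the maximal central subspace of $\ker(\alpha)$. Moreover, let $U'$ be a central complement of $\ker(\alpha)$ in $U$ and let $\mathcal R:=\big(\ell(\alpha,0)\cap(\mathrm{im}(\alpha)\oplus U')\big)\cup\{\mathrm{im}(\alpha)\}$, which is a regulus in $\mathbb P(K,\mathrm{im}(\alpha)\oplus U')$. Then the following statements hold: (a) The set $\ell(\alpha,0)$ is entirely contained in $\mathcal S/M=\{S\in\mathcal S\mid M\le S\}$. (b) The intersection $\ell(\alpha,0)\cap(\mathrm{im}(\alpha)\oplus U'\oplus M)$ is the cone with vertex $M$ over the affine regulus $\mathcal R\setminus\{\mathrm{im}(\alpha)\}$, i.e., the set $$\{X\oplus M\mid X\in\mathcal R,\ X\neq\mathrm{im}(\alpha)\}.$$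
   Context: $K$ is a not necessarily commutative field (division ring) with center $Z$, $V$ is a left vector space over $K$ of arbitrary dimension, $W\le V$ is a subspace with $W\ne\{0\}$, $W\neq V$, $U\le V$ is a fixed complement of $W$ ($V=W\oplus U$), and $(b_i)_{i\in I}$ is a fixed basis of $U$. Linear maps are written as exponents on the right and composed from left to right. $\mathcal S:=\{S\le V\mid V=W\oplus S\}$; for $\gamma\in\mathrm{Hom}(U,W)$ put $U^{(\gamma,1)}:=\{u^\gamma+u\mid u\in U\}$; the map $\gamma\mapsto U^{(\gamma,1)}$ is a bijection $\mathrm{Hom}(U,W)\to\mathcal S$. For $k\in K$ let $\lambda_k\in\mathrm{End}(U)$ be the $K$-linear map with $b_i\mapsto kb_i$. $\mathbb A$ is the affine space with point set $\mathcal S$ associated with the left $K$-vector space structure $U^{(\gamma,1)}+U^{(\eta,1)}=U^{(\gamma+\eta,1)}$, $k\cdot U^{(\gamma,1)}=U^{(\lambda_k\gamma,1)}$; its lines are the sets $\ell(\alpha,\beta):=\{U^{(\lambda_k\alpha+\beta,1)}\mid k\in K\}$ ($\alpha,\beta\in\mathrm{Hom}(U,W)$, $\alpha\ne0$). For a subspace $Y\le V$ write $\ell(\alpha,0)\cap Y:=\{X\cap Y\mid X\in\ell(\alpha,0)\}$. A subspace of $U$ is called central if it possesses a basis consisting of $Z$-linear combinations of the $b_i$. Every subspace of $U$ contains a unique maximal central subspace, and has a complement in $U$ that is central. A regulus in $\mathbb P(K,Y)$ (the projective space of subspaces of $Y$) is a set of subspaces of $Y$ which, for some nonzero left $K$-vector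 space $X$ with a basis $(x_j)_{j\in J}$ and some $K$-linear bijection $X\times X\to Y$, is the image of the standard regulus $\{X\times\{0\}\}\cup\{\{(x^{\lambda_k},x)\mid x\in X\}\mid k\in K\}$, where here $\lambda_k\in\mathrm{End}(X)$ is the linear map with $x_j\mapsto kx_j$. If $A$ is an element of a regulus $\mathcal R$, then $\mathcal R\setminus\{A\}$ is called an affine regulus (with respect to $A$). *)

(* Defs.v *)
From HB Require Import structures.
From mathcomp Require Import all_boot all_order all_algebra.
From mathcomp Require Import finmap.
From mathcomp Require Import boolp classical_sets functions.

Set Implicit Arguments.
Unset Strict Implicit.
Unset Printing Implicit Defensive.

Import GRing.Theory.

Local Open Scope classical_set_scope.
Local Open Scope ring_scope.

(* MathComp has no structure of (noncommutative) division rings: the theorem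
   takes a unitRingType K together with GRing.field_axiom K, i.e. every nonzero
   element is a unit, without commutativity. *)

Definition ring_center (K : pzRingType) : set K :=
  [set z | forall x, GRing.comm z x].

Section Subspaces.
Context {K : nzRingType} {V : lmodType K}.
Implicit Types A B Y S : set V.

Definition is_subspace A : Prop :=
  A 0 /\ forall (k : K) x y, A x -> A y -> A (k *: x + y).

Definition sumset A B : set V := [set x + y | x in A & y in B].

Definition independent A B : Prop := A `&` B = [set 0].

(* Y = A (+) B *)
Definition is_complement Y A B : Prop :=
  [/\ is_subspace B, independent A B & sumset A B = Y].

(* A linear map from the subspace A to the subspace B is represented by a
   function V -> V of which only the restriction to A is meaningful (and used). *)
Definition homs A B : set (V -> V) :=
  [set f | set_fun A B f /\
           forall (k : K) x y, A x -> A y -> f (k *: x + y) = k *: f x + f y].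

Definition kernel A (f : V -> V) : set V := [set x | A x /\ f x = 0].

End Subspaces.

Section Bases.
Context {K : nzRingType} {V : lmodType K} {I : choiceType}.
Implicit Types (b : I -> V) (A : set V).

Definition lincomb b (c : {fsfun I -> K with 0}) : V :=
  \sum_(i <- finsupp c) c i *: b i.

Definition is_basis A b : Prop :=
  (forall c, lincomb b c = 0 -> c = [fsfun]) /\ range (lincomb b) = A.

(* Coordinates of x in the basis b; junk outside the span of b. *)
Definition coords b (x : V) : {fsfun I -> K with 0} :=
  xget [fsfun] [set c | lincomb b c = x].

(* The linear map with b_i |-> k b_i on the span of b. *)
Definition lambda b (k : K) (x : V) : V :=
  \sum_(i <- finsupp (coords b x)) coords b x i *: (k *: b i).

Lemma big_finsupp (c : {fsfun I -> K with 0}) (F : I -> V) (s : {fset I}) :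
  (finsupp c `<=` s)%fset ->
  \sum_(i <- finsupp c) c i *: F i = \sum_(i <- s) c i *: F i.
Proof.
move=> cs; rewrite (big_fset_incl _ cs)// => i _ /fsfun_dflt ->.
by rewrite scale0r.
Qed.

Lemma coords_lincomb A b (c : {fsfun I -> K with 0}) :
  is_basis A b -> coords b (lincomb b c) = c.
Proof.
case=> free_b _; rewrite /coords.
case: xgetP => [d _ /= bd|/(_ c)]; last by move=> /(_ erefl).
pose s := (finsupp d `|` finsupp c)%fset.
pose e : {fsfun I -> K with 0} := [fsfun i in s => d i - c i].
have eE i : e i = d i - c i.
  rewrite fsfunE; case: ifPn => //; rewrite in_fsetU negb_or => /andP[id ic].
  by rewrite !fsfun_dflt// subrr.
have : e = [fsfun].
  apply: free_b; rewrite /lincomb (@big_finsupp _ _ s); last first.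
    by apply/fsubsetP => i; apply: contraLR => is0; rewrite memNfinsupp fsfunE (negPf is0).
  under eq_bigr do rewrite eE scalerBl.
  rewrite sumrB -!big_finsupp ?fsubsetUl ?fsubsetUr//.
  by apply/eqP; rewrite subr_eq0; apply/eqP.
move=> e0; apply/fsfunP => i; apply/eqP; rewrite -subr_eq0 -eE e0.
by rewrite fsfunE.
Qed.

Lemma lambda_basis A b k i : is_basis A b -> lambda b k (b i) = k *: b i.
Proof.
move=> bA; pose d : {fsfun I -> K with 0} := [fsfun j in [fset i]%fset => 1].
have dE F : \sum_(j <- finsupp d) d j *: (F j : V) = F i.
  rewrite (@big_finsupp _ _ [fset i]%fset); last first.
    by apply/fsubsetP => j; apply: contraLR => is0; rewrite memNfinsupp fsfunE (negPf is0).
  by rewrite big_seq_fset1 fsfunE in_fset1 eqxx scale1r.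
by rewrite /lambda -[in coords b _](dE b) (coords_lincomb _ bA) dE.
Qed.

Lemma lambda_homs A b k : is_basis A b -> homs A A (lambda b k).
Proof.
move=> bA; split=> [x|l x y].
  case: (bA) => _ <- [c _ <-]; rewrite /lambda (coords_lincomb _ bA).
  exists [fsfun i in finsupp c => c i * k] => //.
  rewrite /lincomb (@big_finsupp _ _ (finsupp c)).
    by apply: eq_big_seq => i ic; rewrite fsfunE ic scalerA.
  by apply/fsubsetP => j; apply: contraLR => is0; rewrite memNfinsupp fsfunE (negPf is0).
case: (bA) => _ <- [c _ <-] [d _ <-].
pose s := (finsupp d `|` finsupp c)%fset.
pose e : {fsfun I -> K with 0} := [fsfun i in s => l * c i + d i].
have eE i : e i = l * c i + d i.
  rewrite fsfunE; case: ifPn => //; rewrite in_fsetU negb_or => /andP[id ic].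
  by rewrite !fsfun_dflt// mulr0 addr0.
have es : (finsupp e `<=` s)%fset.
  by apply/fsubsetP => j; apply: contraLR => is0; rewrite memNfinsupp fsfunE (negPf is0).
have eF F : l *: (\sum_(i <- finsupp c) c i *: (F i : V)) +
    \sum_(i <- finsupp d) d i *: F i = \sum_(i <- finsupp e) e i *: F i.
  rewrite (big_finsupp F es) (@big_finsupp c F s) ?fsubsetUr//.
  rewrite (@big_finsupp d F s) ?fsubsetUl// scaler_sumr -big_split.
  by apply: eq_bigr => i _; rewrite eE scalerDl scalerA.
by rewrite /lambda /lincomb eF !(coords_lincomb _ bA) eF.
Qed.

End Bases.

Section Central.
Context {K : nzRingType} {V : lmodType K} {I : choiceType} (b : I -> V).
Implicit Types A M : set V.

(* When b is a basis of U, such an A automatically is a subspace of U. *)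
Definition central A : Prop :=
  exists (J : choiceType) (c : J -> V), is_basis A c /\
    forall j, exists2 z : {fsfun I -> K with 0},
      (forall i, ring_center (z i)) & c j = lincomb b z.

Definition max_central A M : Prop :=
  [/\ central M, M `<=` A &
      forall M', central M' -> M' `<=` A -> M `<=` M' -> M' = M].

End Central.

Section Reguli.
Context {K : nzRingType}.

Definition standard_regulus {X : lmodType K} {J : choiceType} (x : J -> X) :
    set (set (X * X)%type) :=
  [set [set p | p.2 = 0]] `|`
  range (fun k => [set (lambda x k v, v) | v in [set: X]]).

Definition regulus {V : lmodType K} (Y : set V) (R : set (set V)) : Prop :=
  exists (X : lmodType K) (J : choiceType) (x : J -> X)
         (f : {linear (X * X)%type -> V}),
    [/\ exists v : X, v != 0,
        is_basis [set: X] x,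
        set_bij [set: (X * X)%type] Y f &
        R = [set f @` A | A in standard_regulus x]].

Definition affine_regulus {V : lmodType K} (Y A : set V) (L : set (set V)) : Prop :=
  exists R, [/\ regulus Y R, R A & L = R `\ A].

End Reguli.

Section AffineSpace.
Context {K : nzRingType} {V : lmodType K} {I : choiceType}.
Variables (U : set V) (b : I -> V).
Implicit Types (alpha beta gamma : V -> V) (L : set (set V)) (S W Y M : set V).

Definition complements W : set (set V) := [set S | is_complement [set: V] W S].

(* U^(gamma,1) *)
Definition graph_space gamma : set V := [set gamma u + u | u in U].

(* l(alpha,beta); maps are composed from left to right, so lambda_k alpha is
   u |-> alpha (lambda_k u). *)
Definition line alpha beta : set (set V) :=
  range (fun k : K => graph_space (fun u => alpha (lambda b k u) + beta u)).

Definition section L Y : set (set V) := [set S `&` Y | S in L].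

Definition cone M L : set (set V) := [set sumset S M | S in L].

End AffineSpace.

(* Main.v *)
Require Import Defs.
From HB Require Import structures.
From mathcomp Require Import all_boot all_order all_algebra.
From mathcomp Require Import finmap.
From mathcomp Require Import boolp classical_sets functions.

(** Everything rests on one property of central subspaces: if [c] is a basis
    of a central subspace [A] of [U] made of [Z]-linear combinations of the
    [b i], then moving [k] past the central coefficients shows that the map
    [lambda b k] sends each [c j] to [k *: c j].  So on [A] it is the map
    [lambda c k] ([lambda_centralE]); in particular it maps [A] to itself.

    Applied to the vertex [M], which lies in [kernel U alpha], this says that
    [alpha (lambda b k m) = 0] for [m] in [M], so each [m] lies on every graph
    of the line: this is (a).

    Applied to [U'], it makes the trace of the line on [Y = im + U'] a regulus.
    By uniqueness of the decomposition along [W] and [U], intersecting a graph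
    over [U] with [Y] leaves the graph over [U'] ([graph_space_cap]).  Since
    [alpha] restricts to a bijection from [U'] onto [im], the map
    [(v, w) |-> alpha v + w] is a linear bijection from [U' * U'] onto [Y]; it
    carries [U' * 0] to [im] and the graph of [lambda c k] to the trace of the
    line at [k] ([graph_regulus]).

    The cone in (b) is then the modular law: each [S] in the line contains [M],
    so [S `&` (Y + M) = (S `&` Y) + M]. *)

Set Implicit Arguments.
Unset Strict Implicit.
Unset Printing Implicit Defensive.

Import GRing.Theory.

Local Open Scope classical_set_scope.
Local Open Scope ring_scope.

(** * Subspaces and linear maps *)

Section SubspaceTheory.
Context {K : nzRingType} {V : lmodType K}.
Implicit Types (A B C P T : set V) (f : V -> V).

Lemma subspaceD A x y : is_subspace A -> A x -> A y -> A (x + y).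
Proof. by move=> [_ cA] Ax Ay; rewrite -[x]scale1r; apply: cA. Qed.

Lemma subspaceZ A k x : is_subspace A -> A x -> A (k *: x).
Proof. by move=> [A0 cA] Ax; rewrite -[_ *: _]addr0; apply: cA. Qed.

Lemma subspaceB A x y : is_subspace A -> A x -> A y -> A (x - y).
Proof. by move=> [_ cA] Ax Ay; rewrite addrC -scaleN1r; apply: cA. Qed.

Lemma independentP A B : A 0 -> B 0 ->
  (forall x, A x -> B x -> x = 0) -> independent A B.
Proof.
move=> A0 B0 AB; apply/seteqP; split=> x /=; first by case; apply: AB.
by move=> ->.
Qed.

Lemma independent0 A B x : independent A B -> A x -> B x -> x = 0.
Proof. by move=> AB Ax Bx; have : (A `&` B) x by []; rewrite AB. Qed.

(** The unique decomposition of the elements of [sumset A B]. *)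
Lemma independent_inj A B a a' t t' : is_subspace A -> is_subspace B ->
  independent A B -> A a -> A a' -> B t -> B t' ->
  a + t = a' + t' -> a = a' /\ t = t'.
Proof.
move=> sA sB AB Aa Aa' Bt Bt' E.
have E' : a - a' = t' - t.
  by apply/eqP; rewrite subr_eq addrAC eq_sym subr_eq [t' + a']addrC E.
have D0 : a - a' = 0.
  by apply: (independent0 AB); [|rewrite E']; apply: subspaceB.
by split; apply/esym/eqP; rewrite -subr_eq0 -?E' ?D0// -opprB D0 oppr0.
Qed.

Lemma homsD A B f x y : homs A B f -> A x -> A y -> f (x + y) = f x + f y.
Proof. by move=> [_ lf] Ax Ay; rewrite -[x in LHS]scale1r lf// scale1r. Qed.

Lemma homs0 A B f : is_subspace A -> homs A B f -> f 0 = 0.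
Proof.
move=> [A0 _] hf; have := homsD hf A0 A0; rewrite addr0 => /esym/eqP.
by rewrite -subr_eq0 addrK => /eqP.
Qed.

Lemma homsZ A B f k x : is_subspace A -> homs A B f -> A x ->
  f (k *: x) = k *: f x.
Proof.
move=> sA hf Ax; case: (hf) => _ lf; case: (sA) => A0 _.
by rewrite -[_ *: x]addr0 lf// (homs0 sA hf) addr0.
Qed.

Lemma homs_sum (J : eqType) A B f (s : seq J) (F : J -> V) :
    is_subspace A -> homs A B f -> (forall j, A (F j)) ->
  A (\sum_(j <- s) F j) /\ f (\sum_(j <- s) F j) = \sum_(j <- s) f (F j).
Proof.
move=> sA hf AF; elim: s => [|j s [As IH]].
  by rewrite !big_nil (homs0 sA hf); case: sA.
by rewrite !big_cons (homsD hf)// IH; split=> //; apply: subspaceD.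
Qed.

Lemma image_subspace A B f : is_subspace A -> homs A B f ->
  is_subspace (f @` A).
Proof.
move=> sA hf; case: (sA) => A0 cA; split; first by exists 0 => //; apply: homs0 hf.
move=> k _ _ [x Ax <-] [y Ay <-]; exists (k *: x + y); first exact: cA.
by case: hf => _ ->.
Qed.

Lemma homs_comp A B C f g : homs A B f -> homs B C g -> homs A C (g \o f).
Proof.
move=> [Af lf] [Bg lg]; split=> [x Ax|k x y Ax Ay] /=; first exact/Bg/Af.
by rewrite lf// lg//; apply: Af.
Qed.

End SubspaceTheory.

(** * Graphs *)

Section Graphs.
Context {K : nzRingType} {V : lmodType K}.
Variables (W U : set V).
Hypotheses (sW : is_subspace W) (cWU : is_complement [set: V] W U).
Implicit Types (gamma : V -> V) (P T : set V).

(** The [W]-part of an element of [W + U] can be corrected by a value of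
    [gamma], hence the sum is everything; an element of the graph that lies in
    [W] has [U]-part [0]. *)
Lemma graph_space_complement gamma : homs U W gamma ->
  complements W (graph_space U gamma).
Proof.
move=> hg; case: (cWU) => sU WU dec; case: (hg) => Wg lg.
case: (sU) => U0 cU; case: (sW) => W0 cW.
have S0 : graph_space U gamma 0 by exists 0; rewrite // (homs0 sU hg) addr0.
split.
- split=> // k _ _ [u Uu <-] [v Uv <-]; exists (k *: u + v); first exact: cU.
  by rewrite lg// scalerDr addrACA.
- apply: independentP => // x Wx [u Uu uE].
  suff u0 : u = 0 by rewrite -uE u0 (homs0 sU hg) addr0.
  apply: (independent0 WU) => //.
  by rewrite -[u](addKr (gamma u)) uE addrC; apply: subspaceB => //; apply: Wg.
apply/seteqP; split=> // v _; have : [set: V] v by [].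
rewrite -dec => -[w Ww [u Uu <-]].
exists (w - gamma u); first by apply: subspaceB => //; apply: Wg.
by exists (gamma u + u); [exists u|rewrite addrA subrK].
Qed.

(** The [U]-part of an element of the graph determines it, and it is the
    [T]-part of any decomposition along [P] and [T]. *)
Lemma graph_space_cap gamma P T : homs U W gamma ->
    P `<=` W -> T `<=` U -> (forall u, T u -> P (gamma u)) ->
  graph_space U gamma `&` sumset P T = graph_space T gamma.
Proof.
move=> [Wg _] PW TU gP; case: cWU => sU WU _; apply/seteqP; split.
  move=> _ [[u Uu <-]] [p Pp [t Tt E]].
  have [_ tu] := independent_inj sW sU WU (PW _ Pp) (Wg _ Uu) (TU _ Tt) Uu E.
  by exists u => //; rewrite -tu.
move=> _ [u Tu <-]; split; first by exists u => //; apply: TU.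
by exists (gamma u); [exact: gP|exists u].
Qed.

End Graphs.

(** * The maps lambda and central subspaces *)

Section CentralTheory.
Context {K : nzRingType} {V : lmodType K} {I : choiceType}.
Variables (U : set V) (b : I -> V).
Hypotheses (sU : is_subspace U) (bU : is_basis U b).

Lemma lambda_lincomb (J : choiceType) A (c : J -> V) k d : is_basis A c ->
  lambda c k (lincomb c d) = \sum_(j <- finsupp d) d j *: (k *: c j).
Proof. by move=> bA; rewrite /lambda (coords_lincomb _ bA). Qed.

Lemma basis_mem (J : choiceType) A (c : J -> V) j : is_basis A c -> A (c j).
Proof.
case=> _ <-; exists [fsfun i in [fset j]%fset => 1] => //.
rewrite /lincomb (@big_finsupp _ _ _ _ _ [fset j]%fset).
  by rewrite big_seq_fset1 fsfunE in_fset1 eqxx scale1r.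
by apply/fsubsetP => i; apply: contraLR => ij; rewrite memNfinsupp fsfunE (negPf ij).
Qed.

(** Centrality of the coefficients is what makes [lambda b k], which is linear
    but is not multiplication by [k] in general, agree with that
    multiplication on the vector. *)
Lemma lambda_central_lincomb k (z : {fsfun I -> K with 0}) :
  (forall i, ring_center (z i)) -> lambda b k (lincomb b z) = k *: lincomb b z.
Proof.
move=> zZ; rewrite (lambda_lincomb _ _ bU) scaler_sumr.
by apply: eq_bigr => i _; rewrite !scalerA zZ.
Qed.

(** Both maps are linear and send each [c j] to [k *: c j], for [lambda b k] by
    the previous lemma. *)
Lemma lambda_centralE (J : choiceType) A (c : J -> V) k u : is_basis A c ->
    (forall j, exists2 z : {fsfun I -> K with 0},
       (forall i, ring_center (z i)) & c j = lincomb b z) ->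
  A u -> lambda b k u = lambda c k u.
Proof.
move=> bA cZ; have cU j : U (c j).
  by have [z _ ->] := cZ j; case: bU => _ <-; exists z.
case: (bA) => _ <- [d _ <-]; rewrite (lambda_lincomb _ _ bA).
have hl := lambda_homs k bU.
rewrite (homs_sum _ sU hl _).2 => [|j]; last exact: subspaceZ.
apply: eq_bigr => j _; rewrite (homsZ _ sU hl)//.
by have [z zZ ->] := cZ j; rewrite lambda_central_lincomb.
Qed.

Lemma lambda_central_stable A k u : central b A -> A u -> A (lambda b k u).
Proof.
move=> [J [c [bA cZ]]] Au; rewrite (lambda_centralE k bA cZ Au).
by case: (lambda_homs k bA) => lA _; apply: lA.
Qed.

Lemma central0 A : central b A -> A 0.
Proof.
move=> [J [c [[_ <-] _]]]; exists [fsfun] => //.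
by rewrite /lincomb big1_fset// => i _ _; rewrite fsfunE scale0r.
Qed.

End CentralTheory.

(** * Reguli from graphs *)

(** Bundling makes the subspace axioms available by inference, so that the
    closure of the membership predicate, and with it the module structure on
    the subtype, can be declared once for all subspaces. *)
Record subspace (K : nzRingType) (V : lmodType K) := Subspace {
  subspace_set : set V;
  subspaceP : is_subspace subspace_set }.

Section SubspaceModule.
Context {K : nzRingType} {V : lmodType K}.
Variable A : subspace V.

Definition subspace_pred : {pred V} := [pred v | `[< subspace_set A v >]].

Lemma subspace_pred_closed : submod_closed subspace_pred.
Proof.
case: (subspaceP A) => A0 cA; split=> [|k x y]; first exact/asboolP.
by move=> /asboolP Ax /asboolP Ay; apply/asboolP/cA.
Qed.

HB.instance Definition _ :=
  GRing.isSubmodClosed.Build K V subspace_pred subspace_pred_closed.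

Record subspace_of := SubspaceOf {
  subspace_val : V;
  subspace_valP : subspace_val \in subspace_pred }.

HB.instance Definition _ := [isSub for subspace_val].
HB.instance Definition _ := [Choice of subspace_of by <:].
HB.instance Definition _ := [SubChoice_isSubLmodule of subspace_of by <:].

Lemma subspace_val_linear : linear subspace_val.
Proof. by move=> k v w; apply: (linearP val). Qed.

HB.instance Definition _ :=
  GRing.isLinear.Build K subspace_of V *:%R subspace_val subspace_val_linear.

Lemma subspace_val_inj : injective subspace_val.
Proof. exact: val_inj. Qed.

Lemma subspace_of_mem (v : subspace_of) : subspace_set A (subspace_val v).
Proof. exact/asboolP/(subspace_valP v). Qed.

Lemma subspace_of_surj v : subspace_set A v -> exists x : subspace_of, subspace_val x = v.
Proof.
move=> Av; have Pv : v \in subspace_pred by apply/asboolP.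
by exists (SubspaceOf Pv).
Qed.

End SubspaceModule.

Section GraphRegulus.
Context {K : nzRingType} {V : lmodType K} {J : choiceType}.
Variables (A W : set V) (c : J -> V) (gamma : V -> V).
Hypotheses (sA : is_subspace A) (bA : is_basis A c).

Local Notation X := (subspace_of (Subspace sA)).

(** A basis of the set [A] is one of the module [A], with the same coordinates,
    hence the same maps [lambda]. *)
Lemma subspace_basis : exists x : J -> X,
  is_basis [set: X] x /\
  forall k v, subspace_val (lambda x k v) = lambda c k (subspace_val v).
Proof.
have /choice [x xE] j : exists x : X, subspace_val x = c j.
  by apply: (@subspace_of_surj _ _ (Subspace sA)); apply: basis_mem bA.
have val_lincomb d : subspace_val (lincomb x d) = lincomb c d.
  by rewrite raddf_sum; apply: eq_bigr => j _; rewrite /= xE.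
have bx : is_basis [set: X] x.
  split=> [d d0|]; first by apply: bA.1; rewrite -val_lincomb d0 raddf0.
  apply/seteqP; split=> // v _; have : range (lincomb c) (subspace_val v).
    by rewrite bA.2; exact: (subspace_of_mem v).
  by case=> d _ dv; exists d => //; apply: subspace_val_inj; rewrite val_lincomb.
exists x; split=> // k v; have : [set: X] v by [].
rewrite -bx.2 => -[d _ <-]; rewrite val_lincomb (lambda_lincomb _ _ bx).
rewrite (lambda_lincomb _ _ bA) raddf_sum; apply: eq_bigr => j _.
by rewrite /= xE.
Qed.

Hypotheses (hg : homs A W gamma) (gA : independent (gamma @` A) A).
Hypothesis gamma_inj : forall u, A u -> gamma u = 0 -> u = 0.

(** The coordinate space of the regulus is [A] itself: the second factor of
    [X * X] goes to [A] by inclusion and the first one to the image by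
    [gamma]. *)
Lemma graph_regulus : (exists2 u, A u & u <> 0) ->
  regulus (sumset (gamma @` A) A)
    (range (fun k => graph_space A (gamma \o lambda c k)) `|`
     [set gamma @` A]).
Proof.
move=> [u Au u0]; have [x [bx xE]] := subspace_basis.
pose f0 (p : (X * X)%type) : V := gamma (subspace_val p.1) + subspace_val p.2.
have valA (v : X) : A (subspace_val v) by exact: (subspace_of_mem v).
have liftA v : A v -> exists y : X, subspace_val y = v.
  by move=> Av; apply: (@subspace_of_surj _ _ (Subspace sA)).
have lf : linear f0.
  move=> k [v w] [v' w']; rewrite /f0 /= !raddfD /=; case: hg => _ ->//.
  by rewrite addrACA.
pose f : {linear (X * X)%type -> V} :=
  HB.pack f0 (GRing.isLinear.Build K (X * X)%type V *:%R f0 lf).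
have fE v w : f (v, w) = gamma (subspace_val v) + subspace_val w by [].
exists X, J, x, f; split=> //.
- have [y yE] := liftA u Au; exists y; apply/eqP => y0.
  by apply: u0; rewrite -yE y0 raddf0.
- split.
  + move=> [v w] _; rewrite fE.
    by exists (gamma (subspace_val v)); [exists (subspace_val v)|exists (subspace_val w)].
  + move=> [v w] [v' w'] _ _; rewrite !fE => E.
    have gv (y : X) : (gamma @` A) (gamma (subspace_val y)) by exists (subspace_val y).
    have [ev ew] := independent_inj (image_subspace sA hg) sA gA
      (gv v) (gv v') (valA w) (valA w') E.
    congr (_, _); apply: subspace_val_inj => //.
    apply/eqP; rewrite -subr_eq0; apply/eqP/gamma_inj.
      by apply: subspaceB.
    have D : A (subspace_val v - subspace_val v') by apply: subspaceB.
    by apply: (addIr (gamma (subspace_val v'))); rewrite -(homsD hg)// subrK add0r.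
  + move=> _ [_ [v Av <-] [w Aw <-]].
    have [[y <-] [z <-]] := (liftA v Av, liftA w Aw).
    by exists (y, z).
have f_im : f @` [set p | p.2 = 0] = gamma @` A.
  apply/seteqP; split=> [_ [[v w] w0 <-]|_ [v Av <-]].
    by rewrite fE (w0 : w = 0) raddf0 addr0; exists (subspace_val v).
  have [y <-] := liftA v Av; exists (y, 0) => //.
  by rewrite fE raddf0 addr0.
have f_graph k : f @` [set (lambda x k v, v) | v in [set: X]] =
    graph_space A (gamma \o lambda c k).
  apply/seteqP; split=> [_ [_ [v _ <-] <-]|_ [v Av <-]].
    by rewrite fE xE; exists (subspace_val v).
  have [y <-] := liftA v Av; exists (lambda x k y, y); first by exists y.
  by rewrite fE xE.
apply/seteqP; split.
  move=> _ [[k _ <-]|->].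
    by exists [set (lambda x k v, v) | v in [set: X]]; [right; exists k|].
  by exists [set p | p.2 = 0]; [left|].
move=> _ [_ [->|[k _ <-]] <-]; first by right.
by left; exists k.
Qed.

End GraphRegulus.

(** * Traces of a line and the cone with vertex M *)

Theorem theorem4p11 (K : unitRingType) (V : lmodType K)
    (W U : set V) (I : choiceType) (b : I -> V)
    (alpha : V -> V) (M U' : set V) :
  GRing.field_axiom K ->
  is_subspace W -> W <> [set 0] -> W <> [set: V] ->
  is_complement [set: V] W U ->
  is_basis U b ->
  homs U W alpha -> (exists2 u, U u & alpha u <> 0) ->
  max_central b (kernel U alpha) M ->
  central b U' -> is_complement U (kernel U alpha) U' ->
  let im := alpha @` U in
  let l := line U b alpha (fun=> 0) in
  let Y := sumset im U' in
  let R := section l Y `|` [set im] in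
  [/\ independent im U', regulus Y R,
      l `<=` [set S | complements W S /\ M `<=` S] &
      [/\ independent Y M,
          affine_regulus Y im (R `\ im),
          forall X, (R `\ im) X -> independent X M &
          section l (sumset Y M) = cone M (R `\ im)]].
Proof.
move=> _ sW _ _ cWU bU ha [u1 Uu1 au1] [cM MK _] cU' [sU' kerU' decU] im l Y R.
case: (cWU) => sU WU _; case: (sU) => U0 _; case: (sU') => U'0 _.
have M0 := central0 cM.
have U'U : U' `<=` U.
  move=> u U'u; rewrite -decU; exists 0; last by exists u; rewrite ?add0r.
  by split=> //; apply: homs0 ha.
have imW : im `<=` W by case: ha => Wa _ _ [u Uu <-]; apply: Wa.
have sim : is_subspace im by apply: image_subspace ha.
(* The summand [0] is the value of the second argument of [line]. *)
pose g k u := alpha (lambda b k u) + 0.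
have gE k : g k = alpha \o lambda b k.
  by apply/funext => u; rewrite /g addr0.
have hg k : homs U W (g k).
  by rewrite gE; apply: homs_comp ha; apply: lambda_homs.
have gim k u : U u -> im (g k u).
  by move=> Uu; rewrite gE; exists (lambda b k u) => //; case: (lambda_homs k bU) => + _; apply.
have im_U' : im = alpha @` U'.
  apply/seteqP; split=> _ [u Uu <-]; last by exists u => //; apply: U'U.
  move: Uu; rewrite -decU => -[v [Uv av] [w U'w <-]].
  by exists w => //; rewrite (homsD ha) ?av ?add0r//; apply: U'U.
have ind_im : independent im U'.
  apply: independentP => //; first by case: sim.
  by move=> x /imW Wx /U'U; apply: independent0 WU Wx.
have cap_Y k : graph_space U (g k) `&` Y = graph_space U' (g k).
  by apply: (graph_space_cap sW cWU (hg k)) => // u /U'U; apply: gim.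
have secE : section l Y = range (fun k => graph_space U' (g k)).
  apply/seteqP; split=> [_ [_ [k _ <-] <-]|_ [k _ <-]].
    by exists k => //; rewrite -cap_Y.
  by exists (graph_space U (g k)); [exists k|exact: cap_Y].
have regR : regulus Y R.
  case: (cU') => J [c [bc cZ]].
  have gc k : graph_space U' (g k) = graph_space U' (alpha \o lambda c k).
    by apply/seteqP; split=> _ [u U'u <-]; exists u => //;
      rewrite gE /= (lambda_centralE sU bU k bc cZ U'u).
  rewrite /R secE (funext gc) /Y im_U'.
  rewrite im_U' in ind_im.
  apply: (@graph_regulus _ _ _ U' W c alpha sU' bc) => //.
  - by case: ha => Wa la; split=> [u /U'U|k x y /U'U Ux /U'U]; [apply: Wa|apply: la].
  - by move=> u U'u au; apply: (independent0 kerU') => //; split=> //; apply: U'U.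
  (* Any preimage in [U'] of the nonzero vector [alpha u1] is nonzero. *)
  have : im (alpha u1) by exists u1.
  rewrite im_U' => -[u U'u uE]; exists u => // u0.
  by apply: au1; rewrite -uE u0 (homs0 sU ha).
have Mg k : M `<=` graph_space U (g k).
  move=> m Mm; have [Um _] := MK _ Mm; exists m => //.
  have [_] := MK _ (lambda_central_stable sU bU k cM Mm).
  by rewrite gE /= => ->; rewrite add0r.
have ind_YM : independent Y M.
  apply: independentP => //; first by exists 0; [case: sim|exists 0; rewrite ?addr0].
  move=> _ [v imv [w U'w <-]] Mx; have [Ux ax] := MK _ Mx.
  (* [v + w] lies in [M], which is contained in [U]; so [v] lies in both [W]
     and [U]. *)
  have v0 : v = 0.
    apply: (independent0 WU); first exact: imW.
    by rewrite -[v](addrK w); apply: subspaceB => //; apply: U'U.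
  rewrite v0 add0r in Ux ax *.
  by apply: (independent0 kerU').
(* A graph is a complement of [W], so it cannot be the nonzero [im]. *)
have RE : R `\ im = section l Y.
  apply/seteqP; split=> [X [[//|->]] /(_ erefl)//|X lX]; split; first by left.
  move=> /= Xim; have : im (alpha u1) by exists u1.
  rewrite -Xim; case: lX => _ [k _ <-] <- [Sa _].
  have [_ ind _] := graph_space_complement sW cWU (hg k).
  by apply: au1; apply: (independent0 ind) => //; case: ha => + _; apply.
split=> //.
  by move=> _ [k _ <-]; split; [apply: (graph_space_complement sW cWU (hg k))|apply: Mg].
split=> //.
- by exists R; split=> //; right.
- rewrite RE => _ [_ [k _ <-] <-]; apply: independentP => //.
    by split; [apply: Mg|exists 0; [case: sim|exists 0; rewrite ?addr0]].
  by move=> x [_ Yx]; apply: independent0 ind_YM Yx.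
have modular k : graph_space U (g k) `&` sumset Y M =
    sumset (graph_space U (g k) `&` Y) M.
  have [sS _ _] := graph_space_complement sW cWU (hg k).
  apply/seteqP; split.
    move=> x [Sx [y Yy [m Mm E]]]; exists y; last by exists m.
    split=> //; rewrite -[y](addrK m) E; apply: subspaceB => //.
    exact: Mg.
  move=> _ [y [Sy Yy] [m Mm <-]]; split; last by exists y => //; exists m.
  by apply: subspaceD => //; apply: Mg.
rewrite RE; apply/seteqP; split.
  move=> _ [_ [k _ <-] <-].
  exists (graph_space U (g k) `&` Y); last by rewrite -modular.
  by exists (graph_space U (g k)) => //; exists k.
move=> _ [_ [_ [k _ <-] <-] <-].
by exists (graph_space U (g k)); [exists k|exact: modular].
Qed.
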